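(* Let $\nu\neq0$ be a symmetric L\'evy measure on $\mathbb{R}^n$ and let $\Omega\subseteq\mathbb{R}^n$ be nonempty, open and bounded. There exists a constant $c>0$, independent of $f$ and $g$, such that whenever $f\in L^2(\Omega)$, $g:\Omega^c\to\mathbb{R}$ and $u$ is a weak solution of the problem $Lu=f$ in $\Omega$, $u=g$ in $\Omega^c$, then $$\|u\|_{L^\infty(\Omega)}\le c\,\|f\|_{L^\infty(\Omega)}+\|g\|_{L^\infty(\mathbb{R}^n\setminus\Omega)}$$ (where the norms on the right-hand side may be infinite).
   Context: All functions are real-valued; $\Omega^c=\mathbb{R}^n\setminus\Omega$. A symmetric L\'evy measure is a nonnegative Borel measure $\nu$ on $\mathbb{R}^n$ with $\nu(\{0\})=0$, $\nu(-A)=\nu(A)$ for every Borel $A$, and $\int_{\mathbb{R}^n}(1\wedge|y|^2)\,d\nu(y)<\infty$. For $x\in\mathbb{R}^n$, $\nu_x(A)=\nu(A-x)$. $V_\nu^\Omega(\mathbb{R}^n)$ is the space of Borel measurable $u$ on $\mathbb{R}^n$ (identified if equal a.e.) with $\|u\|_{L^2(\Omega)}^2+\frac12\int_\Omega\int_{\mathbb{R}^n}(u(x)-u(y))^2\,d\nu_y(x)\,dy<\infty$, and $H_\nu^\Omega(\mathbb{R}^n)=\{u\in V_\nu^\Omega(\mathbb{R}^n):u=0\text{ a.e. in }\Omega^c\}$. A weak solution of the problem $Lu=f$ in $\Omega$, $u=g$ in $\Omega^c$ (where $L$ is the operator associated with $\nu$, $Lu(x)=\lim_{\varepsilon\to0^+}\int_{\mathbb{R}^n\setminus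 B(0,\varepsilon)}(u(x)-u(x+y))\,d\nu(y)$) is a function $u\in V_\nu^\Omega(\mathbb{R}^n)$ such that $u=g$ a.e. in $\Omega^c$ and $$\frac12\int_{\mathbb{R}^n}\int_{\mathbb{R}^n}(u(x)-u(y))(\phi(x)-\phi(y))\,d\nu_y(x)\,dy=\int_\Omega f\phi\,dx\qquad\text{for every }\phi\in H_\nu^\Omega(\mathbb{R}^n).$$ *)

(* Defs.v *)
From HB Require Import structures.
From mathcomp Require Import all_boot all_order all_algebra.
From mathcomp Require Import all_classical all_reals all_analysis.
From mathcomp Require Import lra.

Set Implicit Arguments.
Unset Strict Implicit.
Unset Printing Implicit Defensive.

Import Order.TTheory GRing.Theory Num.Theory.
Import numFieldNormedType.Exports.

Local Open Scope classical_set_scope.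
Local Open Scope ring_scope.

(* Borel sigma-algebra on matrices, in particular on 'rV[R]_n. *)
Definition mx_borel_display : measure_display -> measure_display.
Proof. exact. Qed.

Section borel.
Variables (R : realType) (m n : nat).

Lemma mx_borel0 : <<s @open 'M[R]_(m, n) >> set0.
Proof. exact: sigma_algebra0. Qed.

Lemma mx_borelC (A : set 'M[R]_(m, n)) :
  <<s @open 'M[R]_(m, n) >> A -> <<s @open 'M[R]_(m, n) >> (~` A).
Proof. exact: sigma_algebraC. Qed.

Lemma mx_borel_bigcup (F : (set 'M[R]_(m, n))^nat) :
  (forall i, <<s @open 'M[R]_(m, n) >> (F i)) ->
  <<s @open 'M[R]_(m, n) >> (\bigcup_i F i).
Proof. exact: sigma_algebra_bigcup. Qed.

HB.instance Definition _ :=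
  @isMeasurable.Build (mx_borel_display default_measure_display)
    'M[R]_(m, n) <<s @open 'M[R]_(m, n) >>
    mx_borel0 mx_borelC mx_borel_bigcup.

End borel.

Section lebesgue_outer.
Variables (R : realType) (n : nat).
Local Notation E := 'rV[R]_n.+1.

(* ab = (a, b) stands for the half-open box ]a, b]. In dimension 0 the empty
   set would need a cover by boxes of volume 1, hence the n.+1. *)
Definition box (ab : E * E) : set E :=
  [set x | forall i, ab.1 0 i < x 0 i <= ab.2 0 i].

Definition box_vol (ab : E * E) : R :=
  \prod_i Num.max 0 (ab.2 0 i - ab.1 0 i).

Definition lebesgue_outer (A : set E) : \bar R :=
  ereal_inf [set (\sum_(k <oo) (box_vol (F k))%:E)%E |
             F in [set F : (E * E)^nat | A `<=` \bigcup_k box (F k)]].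

Lemma box_vol_ge0 ab : 0 <= box_vol ab.
Proof. by apply: prodr_ge0 => i _; rewrite le_max lexx. Qed.

Lemma box_vol00 : box_vol (0, 0) = 0.
Proof. by rewrite /box_vol big_ord_recl /= subrr maxxx mul0r. Qed.

Lemma lebesgue_outer_ge0 A : (0 <= lebesgue_outer A)%E.
Proof.
apply: le_ereal_inf_tmp => _ [F _ <-].
by apply: nneseries_ge0 => k _ _; rewrite lee_fin box_vol_ge0.
Qed.

Lemma lebesgue_outer0 : lebesgue_outer set0 = 0%E.
Proof.
apply/eqP; rewrite eq_le lebesgue_outer_ge0 andbT.
apply: ereal_inf_lbound; exists (fun=> (0, 0)) => //=.
by apply: eseries0 => k _ _; rewrite box_vol00.
Qed.

Lemma le_lebesgue_outer : {homo lebesgue_outer : A B / A `<=` B >-> (A <= B)%E}.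
Proof.
move=> A B AB; apply: ereal_inf_le_tmp => _ [F BF <-].
by exists F => //; exact: subset_trans AB BF.
Qed.

Lemma lebesgue_outer_sigma_subadditive : sigma_subadditive lebesgue_outer.
Proof.
move=> A; have [[i ioo]|] := pselect (exists i, lebesgue_outer (A i) = +oo%E).
  rewrite (eseries_pinfty _ _ ioo) ?leey// => k _.
  by rewrite -ltNye (lt_le_trans _ (lebesgue_outer_ge0 _)).
rewrite -forallNE => Aoo.
suff add2e (e : {posnum R}) : (lebesgue_outer (\bigcup_n A n) <=
    \sum_(i <oo) lebesgue_outer (A i) + e%:num%:E)%E.
  by apply/lee_addgt0Pr => _/posnumP[].
rewrite (le_trans _ (epsilon_trick _ _ _))//; last first.
  by move=> k; exact: lebesgue_outer_ge0.
pose P k (B : (E * E)^nat) := A k `<=` \bigcup_j box (B j) /\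
  (\sum_(j <oo) (box_vol (B j))%:E <=
    lebesgue_outer (A k) + (e%:num / (2 ^ k.+1)%:R)%:E)%E.
have [G PG] : {G : ((E * E)^nat)^nat & forall k, P k (G k)}.
  apply: (@choice _ _ P) => k; rewrite /P.
  have Afin : lebesgue_outer (A k) \is a fin_num.
    rewrite ge0_fin_numE ?lebesgue_outer_ge0// ltey; exact/eqP/Aoo.
  have en1 : 0 < e%:num / (2 ^ k.+1)%:R by [].
  have [x [B AB <-] xS] := lb_ereal_inf_adherent en1 Afin.
  by exists B; split => //; exact/ltW.
pose v (p : nat * nat) : \bar R := (box_vol (G p.1 p.2))%:E.
have v_ge0 p : (0 <= v p)%E by rewrite lee_fin box_vol_ge0.
apply: (@le_trans _ _ (\esum_(p in setT) v p)%E).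
  have /card_esym/ppcard_eqP[f] := card_nat2.
  apply: ereal_inf_lbound => /=; exists (fun k => G (f k).1 (f k).2).
    move=> x [i _] /(PG i).1 [j _ Gx]; exists (f^-1%FUN (i, j)) => //=.
    by rewrite invK ?inE.
  rewrite -(esum_pred_image v _ xpredT) ?[fun=> _]set_true//.
  by rewrite image_eq.
rewrite (_ : esum _ _ = \sum_(i <oo) \sum_(j <oo) v (i, j))%E; last first.
  pose J : nat -> set (nat * nat) := fun i => [set (i, j) | j in setT].
  rewrite (_ : setT = \bigcup_k J k); last first.
    by rewrite predeqE => -[a b]; split => // _; exists a => //; exists b.
  rewrite esum_bigcupT /=; last 2 first.
    - apply/trivIsetP => i j _ _ ij.
      rewrite predeqE => -[k m] /=; split => //= -[] [_] _ [<-{k} _].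
      by move=> [m' _] [] /esym/eqP; rewrite (negbTE ij).
    - by move=> p; exact: v_ge0.
  rewrite -(image_id [set: nat]) -fun_true esum_pred_image//; last first.
    by move=> k _; exact: esum_ge0.
  apply: eq_eseriesr => /= j _.
  rewrite -(esum_pred_image v (pair j) predT)//=; last first.
    by move=> ? ? _ _; exact: (@can_inj _ _ _ snd).
  by congr esum; rewrite predeqE => -[a b]; split; move=> [i _ <-]; exists i.
apply: lee_lim.
- by apply: is_cvg_nneseries => k *; apply: nneseries_ge0 => m *; exact: v_ge0.
- apply: is_cvg_nneseries => k *.
  by apply: adde_ge0; [exact: lebesgue_outer_ge0|rewrite lee_fin].
- by near=> k; apply: lee_sum => i _; exact: (PG i).2.
Unshelve. all: by end_near. Qed.

HB.instance Definition _ := isOuterMeasure.Build R E lebesgue_outer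
  lebesgue_outer0 lebesgue_outer_ge0 le_lebesgue_outer
  lebesgue_outer_sigma_subadditive.

Let below (i : 'I_n.+1) (t : R) : set E := [set x | x 0 i <= t].

Let cutl (i : 'I_n.+1) (t : R) (ab : E * E) : E * E :=
  (ab.1, \row_j if j == i then Num.min (ab.2 0 j) t else ab.2 0 j).

Let cutr (i : 'I_n.+1) (t : R) (ab : E * E) : E * E :=
  (\row_j if j == i then Num.max (ab.1 0 j) t else ab.1 0 j, ab.2).

Let box_cutl i t ab : box ab `&` below i t `<=` box (cutl i t ab).
Proof.
move=> x [xab xt] j; rewrite /= mxE; have /andP[-> xb] := xab j.
by case: eqP => [ji|//]; rewrite le_min xb ji.
Qed.

Let box_cutr i t ab : box ab `&` ~` below i t `<=` box (cutr i t ab).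
Proof.
move=> x [xab /negP]; rewrite -ltNge => tx j; rewrite /= mxE.
have /andP[ax ->] := xab j.
by rewrite andbT; case: eqP => [ji|//]; rewrite gt_max ax ji tx.
Qed.

Let box_vol_cut i t ab :
  box_vol ab = box_vol (cutl i t ab) + box_vol (cutr i t ab).
Proof.
rewrite /box_vol (bigD1 i)//= [in X in _ = X + _](bigD1 i)//=.
rewrite [in X in _ = _ + X](bigD1 i)//= !mxE eqxx.
under [in X in _ = _ * X + _]eq_bigr => j ji do rewrite mxE (negbTE ji).
under [in X in _ = _ + _ * X]eq_bigr => j ji do rewrite mxE (negbTE ji).
rewrite -mulrDl; congr (_ * _); move: (ab.1 0 i) (ab.2 0 i) => a b.
rewrite !maxEle !minEle.
by do !case: ifPn; rewrite -?ltNge; lra.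
Qed.

Let below_caratheodory i t : lebesgue_outer.-caratheodory (below i t).
Proof.
apply: le_caratheodory_measurable => X.
apply: le_ereal_inf_tmp => _ [F XF <-].
under eq_eseriesr do rewrite (box_vol_cut i t) EFinD.
rewrite nneseriesD; last 2 first.
- by move=> k _; rewrite lee_fin box_vol_ge0.
- by move=> k _; rewrite lee_fin box_vol_ge0.
apply: leeD; apply: ereal_inf_lbound.
- exists (fun k => cutl i t (F k)) => // x [/XF[k _ Fx] xt].
  by exists k => //; exact: box_cutl.
- exists (fun k => cutr i t (F k)) => // x [/XF[k _ Fx] xt].
  by exists k => //; exact: box_cutr.
Qed.

Let box_caratheodory ab : lebesgue_outer.-caratheodory (box ab).
Proof.
pose cT := caratheodory_type lebesgue_outer.
rewrite (_ : box ab = \bigcap_(i in [set: 'I_n.+1])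
    (~` below i (ab.1 0 i) `&` below i (ab.2 0 i))); last first.
  apply/seteqP; split=> x /= xab i.
    by have /andP[] := xab i; rewrite ltNge => /negP.
  by have [/negP] := xab i I; rewrite -ltNge /below /= => -> ->.
apply: (@fin_bigcap_measurable _ cT) => // i _.
apply: (@measurableI _ cT); last exact: below_caratheodory.
by apply: (@measurableC _ cT); exact: below_caratheodory.
Qed.

Let open_caratheodory (A : set E) : open A -> lebesgue_outer.-caratheodory A.
Proof.
move=> oA; pose cT := caratheodory_type lebesgue_outer.
pose Q := ('rV[rat]_n.+1 * 'rV[rat]_n.+1)%type.
pose q2r (p : Q) : E * E := (map_mx ratr p.1, map_mx ratr p.2).
rewrite (_ : A = \bigcup_(p : Q)
    (if `[< box (q2r p) `<=` A >] then box (q2r p) else set0)); last first.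
  apply/seteqP; split=> [x Ax|x [p _]]; last by case: asboolP => // /[apply].
  have /nbhs_ballP[e /= e0 eA] : nbhs x A by exact: open_nbhs_nbhs.
  have h1 i : exists q : rat, x 0 i - e < ratr q < x 0 i.
    by have [|q /[!in_itv]] := @rat_in_itvoo R (x 0 i - e) (x 0 i);
      [lra|exists q].
  have h2 i : exists q : rat, x 0 i < ratr q < x 0 i + e.
    by have [|q /[!in_itv]] := @rat_in_itvoo R (x 0 i) (x 0 i + e);
      [lra|exists q].
  have [a ha] := choice h1; have [b hb] := choice h2.
  exists (\row_i a i, \row_i b i) => //; case: asboolP => [_|[]].
    move=> i; rewrite /= !mxE; have := ha i; have := hb i; lra.
  move=> y yab; apply: eA; split => // j i; rewrite (ord1 j).
  have := yab i; rewrite /= !mxE; have := ha i; have := hb i.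
  by rewrite /ball /= ltr_distl; lra.
apply: (@countable_bigcupT_measurable _ cT) => [|p].
  exact: countableP.
case: asboolP => _; first exact: box_caratheodory.
exact: (@measurable0 _ cT).
Qed.

Let borel_caratheodory (A : set E) :
  measurable A -> lebesgue_outer.-caratheodory A.
Proof.
apply: smallest_sub; last exact: open_caratheodory.
exact: (@sigma_algebra_measurable _ (caratheodory_type lebesgue_outer)).
Qed.

Definition lebesgue_rV : set E -> \bar R := lebesgue_outer.

Let lebesgue_rV_sigma_additive : semi_sigma_additive lebesgue_rV.
Proof.
move=> F mF tF mUF; apply: caratheodory_measure_sigma_additive => //.
- by move=> i; exact: borel_caratheodory.
- exact: borel_caratheodory.
Qed.

HB.instance Definition _ := isMeasure.Build _ _ _ lebesgue_rV
  lebesgue_outer0 lebesgue_outer_ge0 lebesgue_rV_sigma_additive.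

End lebesgue_outer.

Section levy.
Variables (R : realType) (n : nat).
Local Notation E := 'rV[R]_n.+1.
Local Notation leb := (@lebesgue_rV R n).
Implicit Types (nu : {measure set E -> \bar R}) (D : set E) (u f g phi : E -> R).

(* Euclidean norm; the norm `|y| of the library on 'rV[R]_n is the max norm. *)
Definition enorm (y : E) : R := Num.sqrt (\sum_i y 0 i ^+ 2).

Definition symmetric_levy nu : Prop :=
  [/\ nu [set 0] = 0%E,
      forall A : set E, measurable A -> nu [set - y | y in A] = nu A &
      (\int[nu]_y (Num.min 1 (enorm y ^+ 2))%:E < +oo)%E].

(* nu_x(A) = nu(A - x) *)
Definition levy_shift nu (x : E) : set E -> \bar R :=
  pushforward nu (fun h : E => x + h).

Let measurable_translation (x : E) :
  measurable_fun [set: E] (fun h : E => x + h).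
Proof.
have trC : continuous (fun h : E => x + h).
  by move=> h; apply: (@cvgD R E E (nbhs h) _ (cst x) id x h);
    [exact: cvg_cst|exact: cvg_id].
apply: (@measurability _ _ _ _ _ _ (@open E)) => // _ [A oA <-].
rewrite setTI; apply: sub_sigma_algebra.
by apply: open_comp oA => h _; exact: trC.
Qed.

HB.instance Definition _ nu x := Measure.copy (levy_shift nu x)
  (measure_function_pushforward__canonical__measure_function_Measure nu
     (measurable_translation x)).

Definition L2on D f : Prop :=
  measurable_fun D f /\ (\int[leb]_(x in D) (f x ^+ 2)%:E < +oo)%E.

(* ||f||_{L^oo(D)} with value in [0, +oo]; only the values of f on D matter *)
Definition Linfty_norm D f : \bar R := ('N[leb]_+oo[EFin \o (f \_ D)])%E.

(* Functions are Borel representatives of their a.e. classes. *)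
Definition Vspace nu D u : Prop :=
  measurable_fun [set: E] u /\
  (\int[leb]_(x in D) (u x ^+ 2)%:E +
   2^-1%:E * \int[leb]_(y in D) \int[levy_shift nu y]_x ((u x - u y) ^+ 2)%:E
   < +oo)%E.

Definition Hspace nu D u : Prop :=
  Vspace nu D u /\ {ae leb, forall x, (~` D) x -> u x = 0}.

Definition weak_solution nu D f g u : Prop :=
  [/\ Vspace nu D u,
      {ae leb, forall x, (~` D) x -> u x = g x} &
      forall phi, Hspace nu D phi ->
        (2^-1%:E * \int[leb]_y \int[levy_shift nu y]_x
            ((u x - u y) * (phi x - phi y))%:E =
         \int[leb]_(x in D) (f x * phi x)%:E)%E].

End levy.

(* Main.v *)
From HB Require Import structures.
Require Import Defs.
From mathcomp Require Import all_boot all_order all_algebra.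
From mathcomp Require Import all_classical all_reals all_analysis.
From mathcomp Require Import measurable_realfun ess_sup_inf lra ring.

Set Implicit Arguments.
Unset Strict Implicit.
Unset Printing Implicit Defensive.

Import Order.TTheory GRing.Theory Num.Theory.
Import numFieldNormedType.Exports.

Local Open Scope classical_set_scope.
Local Open Scope ring_scope.

(** The proof compares [u] with an explicit barrier. Write [Lw] for the operator
    attached to [nu]. The cosine wave [w x = cos (t * x_i)] is an eigenfunction:
    [Lw = psi w], where [psi] is the integral of [1 - cos (t * h_i)] against
    [nu]. Since [nu] is a nonzero measure without mass at the origin, some
    coordinate [i] gives [psi > 0] for every small [t > 0]; the Levy condition
    gives [psi < +oo]; and since [Omega] is bounded, [w >= 1/2] on [Omega] once
    [t] is small. So [w] is a bounded function with [Lw >= psi / 2] on [Omega],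
    whatever the structure of [nu].

    Let [M] and [N] be the norms of [f] and [g], let [k > 2 M / psi], put
    [b = k (1 + w) + N] and test the equation with [phi = (u - b)^+]. Because
    [b >= N], [phi] vanishes outside [Omega] and belongs to [Hspace]. Pointwise,
    the increments of [u - b] and of [phi] have the same sign, and constants do
    not contribute to increments, so the form of [(u, phi)] dominates the form
    of [(k w, phi)]. The eigenfunction property in weak form
    ([cosine_wave_energy]) evaluates the latter as [k psi] times the integral of
    [w phi], which is at least [k psi / 2] times the integral of [phi]; the
    former is the integral of [f phi], at most [M] times the integral of [phi].
    As [M < k psi / 2], the integral of [phi] is [0], that is
    [u <= b <= 2 k + N] almost everywhere in [Omega]
    ([weak_subsolution_bound]). Applied to [u] and [- u], with [k] decreasing
    to [2 M / psi], this is the theorem with [c = 4 / psi].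

    The form is written with increments [u (y + h) - u y] against the product
    of Lebesgue measure and [nu], so that Fubini's theorem and translation
    invariance apply. With [h] fixed, the integral over [y] of
    [(w (y + h) - w y) (phi (y + h) - phi y)] is a finite computation; the
    analytic point is the integrability of this product
    ([integrable_increment_product]): the energy controls the pairs
    [(y, y + h)] starting in [Omega], and the symmetry of [nu] carries this
    over to the pairs ending in [Omega]. *)

(** * Monotonicity and transport of integrals *)

(** The integral is the difference of two suprema over simple functions, each
    monotone, and extended subtraction is monotone even where it reads
    [+oo - +oo = -oo]. The energy of a weak solution against a test function can
    thus be bounded below without discussing its integrability. *)
Lemma le_integral_pointwise d (T : measurableType d) (R : realType)
    (mu : {measure set T -> \bar R}) (D : set T) (f g : T -> \bar R) :
  (forall x, D x -> (f x <= g x)%E) ->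
  (\int[mu]_(x in D) f x <= \int[mu]_(x in D) g x)%E.
Proof.
move=> fg; rewrite (integral_mkcond _ f) (integral_mkcond _ g).
have {}fg x : ((f \_ D) x <= (g \_ D) x)%E.
  by rewrite !patchE; case: ifPn => // /set_mem/fg.
rewrite integralE [leRHS]integralE.
apply: leeB; rewrite !ge0_integralTE//; apply: ge_ereal_sup => _ [h /= hf <-];
  apply: ereal_sup_ubound; exists h => // x; apply: le_trans (hf x) _.
- by rewrite !funeposE ge_max !le_max fg lexx/= orbT.
- by rewrite !funenegE ge_max !le_max leeN2 fg lexx/= orbT.
Qed.

Lemma integral_image_measure d1 d2 (T1 : measurableType d1)
    (T2 : measurableType d2) (R : realType)
    (mu : {measure set T1 -> \bar R}) (nu : {measure set T2 -> \bar R})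
    (p : T1 -> T2) (f : T2 -> \bar R) :
  measurable_fun [set: T1] p ->
  (forall A, measurable A -> mu (p @^-1` A) = nu A) ->
  measurable_fun [set: T2] f ->
  (\int[mu]_x f (p x) = \int[nu]_x f x)%E.
Proof.
move=> mp pmu mf.
have ge0 g : measurable_fun setT g -> (forall x, 0 <= g x)%E ->
    (\int[mu]_x g (p x) = \int[nu]_x g x)%E.
  move=> mg g0; rewrite -(ge0_integral_pushforward mp mu measurableT mg)//.
  by apply: (@eq_measure_integral _ _ _ _ nu) => A mA _; exact: pmu.
rewrite integralE [RHS]integralE.
rewrite -(ge0 (f^\+)%E (measurable_funepos mf))//.
by rewrite -(ge0 (f^\-)%E (measurable_funeneg mf))// funepos_comp funeneg_comp.
Qed.

(** * Borel sets and Lebesgue measure on row vectors *)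

Section euclidean.
Context (R : realType) (n : nat).
Local Notation E := 'rV[R]_n.+1.

Lemma measurable_coord (i : 'I_n.+1) :
  measurable_fun [set: E] (fun x : E => x 0 i).
Proof.
apply: (measurability _ (RGenOInfty.measurableE R)) => _ [_ [a ->] <-].
rewrite setTI; apply: sub_sigma_algebra.
apply: open_comp (@interval_open _ _ _ _ _) => // h _.
exact: coord_continuous.
Qed.

(** Rationals lie strictly between [x_i - e], [x_i] and [x_i + e], so each point
    of an open set lies in a box with rational corners inside that set. The union
    is countable, which ties the Borel sigma-algebra to the coordinates. *)
Lemma open_bigcup_box (A : set E) : open A ->
  A = \bigcup_(p in [set p : 'rV[rat]_n.+1 * 'rV[rat]_n.+1 |
        box (map_mx ratr p.1, map_mx ratr p.2) `<=` A])
      box (map_mx ratr p.1, map_mx ratr p.2).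
Proof.
move=> oA; apply/seteqP; split=> [x Ax|x [p /= pA] /pA//].
have /nbhs_ballP[e /= e0 eA] : nbhs x A by exact: open_nbhs_nbhs.
have h1 i : exists q : rat, x 0 i - e < ratr q < x 0 i.
  by have [|q /[!in_itv]] := @rat_in_itvoo R (x 0 i - e) (x 0 i);
    [lra|exists q].
have h2 i : exists q : rat, x 0 i < ratr q < x 0 i + e.
  by have [|q /[!in_itv]] := @rat_in_itvoo R (x 0 i) (x 0 i + e);
    [lra|exists q].
have [a ha] := choice h1; have [b hb] := choice h2.
exists (\row_i a i, \row_i b i) => /=.
  move=> y yab; apply: eA; split => // j i; rewrite (ord1 j).
  have := yab i; rewrite /= !mxE; have := ha i; have := hb i.
  by rewrite /ball /= ltr_distl; lra.
by move=> i; rewrite /= !mxE; have := ha i; have := hb i; lra.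
Qed.

(** In particular a map into row vectors that is measurable for a product
    sigma-algebra can be recognized on coordinates, which is how [y + h] is seen
    to be measurable in the pair [(y, h)]. *)
Lemma measurable_row d (T : measurableType d) (f : T -> E) :
  (forall i, measurable_fun [set: T] (fun t => f t 0 i)) ->
  measurable_fun [set: T] f.
Proof.
move=> mf; apply: (@measurability _ _ _ _ _ _ (@open E)) => // _ [A oA <-].
rewrite setTI (open_bigcup_box oA) preimage_bigcup bigcup_mkcond.
apply: countable_bigcupT_measurable => [|p]; first exact: countableP.
case: ifPn => // _.
rewrite (_ : _ @^-1` _ = \bigcap_(i in [set: 'I_n.+1])
   ((fun t => f t 0 i) @^-1` `](map_mx ratr p.1) 0 i, (map_mx ratr p.2) 0 i])).
  apply: fin_bigcap_measurable => // i _.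
  by rewrite -[X in measurable X]setTI; exact: mf.
apply/seteqP; split=> t /= tp i; first by move=> _; rewrite /= in_itv /= tp.
by have := tp i Logic.I; rewrite /= in_itv.
Qed.

Lemma measurable_rowD : measurable_fun [set: E * E] (fun p => p.1 + p.2).
Proof.
apply: measurable_row => i; under eq_fun do rewrite mxE.
by apply: measurable_funD; apply: (measurableT_comp (measurable_coord i)).
Qed.

Lemma measurable_rowN : measurable_fun [set: E] (fun x => - x).
Proof.
apply: measurable_row => i; under eq_fun do rewrite mxE.
exact: measurableT_comp (measurable_coord i).
Qed.

End euclidean.

Section lebesgue_row.
Context (R : realType) (n : nat).
Local Notation E := 'rV[R]_n.+1.
Local Notation leb := (@lebesgue_rV R n).

Lemma measurable_box (ab : E * E) : measurable (box ab).
Proof.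
rewrite (_ : box ab = \bigcap_(i in [set: 'I_n.+1])
   ((fun x : E => x 0 i) @^-1` `]ab.1 0 i, ab.2 0 i])).
  apply: fin_bigcap_measurable => // i _.
  by rewrite -[X in measurable X]setTI; exact: measurable_coord.
apply/seteqP; split=> x /= xab i; first by move=> _; rewrite /= in_itv /= xab.
by have := xab i Logic.I; rewrite /= in_itv.
Qed.

Lemma lebesgue_rV_box (ab : E * E) : (leb (box ab) <= (box_vol ab)%:E)%E.
Proof.
apply: ereal_inf_lbound; exists
  (fun k : nat => if k == 0%N then ab else (0, 0) : E * E) => /=.
  by move=> x xab; exists 0%N.
rewrite (@nneseriesD1 _ _ 0%N)//= ?eseries0 ?adde0// => [[|k]|k _]//=.
  by rewrite box_vol00.
by rewrite lee_fin box_vol_ge0.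
Qed.

Lemma ler_coord_norm (x : E) i : `|x 0 i| <= `|x|.
Proof.
rewrite [leRHS]mx_normrE.
exact: (le_bigmax _ (fun j : 'I_1 * 'I_n.+1 => `|x j.1 j.2|) (0, i)).
Qed.

Lemma lebesgue_rV_bounded (A : set E) : bounded_set A -> (leb A < +oo)%E.
Proof.
move=> [M [_ bA]]; pose k := `|M| + 1.
have {}bA x : A x -> `|x| <= k.
  by apply: bA; rewrite /k (le_lt_trans (ler_norm _))// ltrDl.
apply: (@le_lt_trans _ _ (leb (box (const_mx (- k - 1), const_mx k)))).
  apply: le_outer_measure => x /bA xk i; rewrite !mxE.
  have := ler_coord_norm x i; rewrite ler_norml; lra.
by rewrite (le_lt_trans (lebesgue_rV_box _))// ltry.
Qed.

Let shift_box (h : E) (ab : E * E) : E * E := (ab.1 - h, ab.2 - h).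

Let box_vol_shift h ab : box_vol (shift_box h ab) = box_vol ab.
Proof.
rewrite /box_vol; apply: eq_bigr => i _; rewrite !mxE.
by congr (Num.max 0 _); lra.
Qed.

(** Translating a cover by boxes gives a cover of the translate with the same
    volumes; the converse inequality is the same one for [- h]. *)
Lemma lebesgue_rV_shift (h : E) (A : set E) :
  leb ((fun x => x + h) @^-1` A) = leb A.
Proof.
have le (g : E) (B : set E) : (leb ((fun x => (x + g)%R) @^-1` B) <= leb B)%E.
  apply: le_ereal_inf_tmp => _ [F BF <-].
  apply: ereal_inf_lbound; exists (fun k => shift_box g (F k)).
    move=> x /BF[k _ Fx]; exists k => // i.
    have := Fx i; rewrite !mxE; lra.
  by apply: eq_eseriesr => k _; rewrite box_vol_shift.
apply/eqP; rewrite eq_le le/=.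
rewrite (le_trans _ (le (- h) _))// le_outer_measure//.
by move=> x Ax /=; rewrite subrK.
Qed.

Lemma lebesgue_rV_sigma_finite : sigma_finite [set: E] leb.
Proof.
exists (fun k => box (const_mx (- k%:R), const_mx k%:R)).
  apply/esym/seteqP; split=> // x _.
  exists (Num.truncn `|x|).+1 => // i; rewrite !mxE.
  have := truncnS_gt `|x|.
  have := ler_coord_norm x i; rewrite ler_norml; lra.
move=> k; split; first exact: measurable_box.
by rewrite (le_lt_trans (lebesgue_rV_box _))// ltry.
Qed.

HB.instance Definition _ := @Measure_isSigmaFinite.Build _ _ _ leb
  lebesgue_rV_sigma_finite.

End lebesgue_row.

(** * The cosine and its symbol *)

Section cosine.
Context (R : realType).
Implicit Types a s : R.

Lemma ler_norm_sin s : `|sin s| <= `|s|.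
Proof.
wlog s0 : s / 0 <= s => [h|].
  have [/h//|/ltW s0] := leP 0 s.
  by rewrite -normrN -sinN -[leRHS]normrN h// oppr_ge0.
have [->|sn0] := eqVneq s 0; first by rewrite sin0.
have {}s0 : 0 < s by rewrite lt0r sn0.
have cs : {within `[0, s], continuous (@sin R)}.
  by apply: continuous_subspaceT => y; exact: continuous_sin.
have [c _] := MVT s0 (fun x _ => is_derive_sin x) cs.
rewrite sin0 !subr0 => ->; rewrite normrM.
by rewrite ler_piMl// cos_max.
Qed.

Lemma onem_cosE s : 1 - cos s = sin (s / 2) ^+ 2 *+ 2.
Proof.
rewrite {1}(_ : s = (s / 2) *+ 2); last by lra.
by rewrite cos_mulr2n cos2sin2; lra.
Qed.

Lemma onem_cos_ge0 s : 0 <= 1 - cos s.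
Proof. by rewrite subr_ge0 cos_le1. Qed.

Lemma onem_cos_le s : 1 - cos s <= s ^+ 2 / 2.
Proof.
have := ler_norm_sin (s / 2); rewrite onem_cosE.
rewrite -ler_sqr ?nnegrE// !real_normK ?num_real//; nra.
Qed.

Lemma onem_cos_gt0 s : 0 < `|s| <= 1 -> 0 < 1 - cos s.
Proof.
move=> s01; rewrite -cos_norm onem_cosE pmulrn_lgt0// exprn_gt0//.
apply: sin_gt0_pi; have := pi_ge2 R; lra.
Qed.

(** The Cauchy-Schwarz inequality for
    [cos (a + s) - cos a = cos a (cos s - 1) - sin a sin s]. The bound depends
    only on [s] and has the same integral against [nu] as the symbol, up to the
    factor [2]. *)
Lemma sqr_cos_increment_le a s : (cos (a + s) - cos a) ^+ 2 <= (1 - cos s) *+ 2.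
Proof.
rewrite cosD; have := cos2Dsin2 a; have := cos2Dsin2 s.
set c := cos a; set d := sin a; set p := cos s; set q := sin s => pq cd.
have -> : (1 - p) *+ 2 = (c ^+ 2 + d ^+ 2) * ((p - 1) ^+ 2 + q ^+ 2).
  by rewrite cd; lra.
have := sqr_ge0 (c * q + d * (p - 1)); nra.
Qed.

End cosine.

Section levy_measure.
Context (R : realType) (n : nat).
Local Notation E := 'rV[R]_n.+1.
Implicit Types (nu : {measure set E -> \bar R}).

Lemma row_neq0_coord (y : E) : y != 0 -> exists i, y 0 i != 0.
Proof.
move=> y0; apply: contrapT => /forallNP yi; case/negP: y0.
by apply/eqP/rowP => i; rewrite mxE; apply/eqP; exact/negbNE/negP/yi.
Qed.

Lemma measurable_row0 : measurable [set (0 : E)].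
Proof.
rewrite (_ : [set _] = \bigcap_(i in [set: 'I_n.+1])
    ((fun x : E => x 0 i) @^-1` [set 0])).
  apply: fin_bigcap_measurable => // i _.
  by rewrite -[X in measurable X]setTI; exact: measurable_coord.
apply/seteqP; split=> [_ -> i _|x x0]; rewrite /= ?mxE//.
by apply/rowP => i; rewrite mxE; exact: x0.
Qed.

Lemma enorm2E (y : E) : enorm y ^+ 2 = \sum_i y 0 i ^+ 2.
Proof. by rewrite sqr_sqrtr// sumr_ge0// => i _; exact: sqr_ge0. Qed.

Lemma ler_coord_enorm2 (y : E) i : y 0 i ^+ 2 <= enorm y ^+ 2.
Proof.
rewrite enorm2E (bigD1 i)//= lerDl sumr_ge0// => j _; exact: sqr_ge0.
Qed.

Lemma enorm2_gt0 (y : E) : y != 0 -> 0 < enorm y ^+ 2.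
Proof.
move=> y0; have [i yi] := row_neq0_coord y0.
by rewrite (lt_le_trans _ (ler_coord_enorm2 _ i))// exprn_even_gt0.
Qed.

Lemma measurable_levy_weight :
  measurable_fun [set: E] (fun y : E => Num.min 1 (enorm y ^+ 2)).
Proof.
apply: measurable_minr => //; under eq_fun do rewrite enorm2E.
apply: measurable_sum => i; apply: measurable_funX; exact: measurable_coord.
Qed.

(** Markov's inequality for the weight [min (1, |y|^2)], which is integrable and
    positive off the origin. Fubini's theorem relies on this. *)
Lemma levy_sigma_finite nu : symmetric_levy nu -> sigma_finite [set: E] nu.
Proof.
move=> [nu0 _ nufin].
have m0 := measurable_row0.
pose far k := [set y : E | k.+1%:R^-1 <= Num.min 1 (enorm y ^+ 2)].
have mfar k : measurable (far k).
  rewrite -[X in measurable X]setTI.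
  rewrite (_ : far k = (fun y => Num.min 1 (enorm y ^+ 2)) @^-1` `[k.+1%:R^-1, +oo[).
    exact: measurable_levy_weight.
  by apply/seteqP; split=> y; rewrite /= in_itv/= andbT.
exists (fun k => far k `|` [set 0]).
  apply/esym/seteqP; split=> // y _.
  have [->|/enorm2_gt0 y0] := eqVneq y 0; first by exists 0%N => //; right.
  have m0' : 0 < Num.min 1 (enorm y ^+ 2) by rewrite lt_min ltr01.
  exists (Num.truncn (Num.min 1 (enorm y ^+ 2))^-1) => //; left; rewrite /far /=.
  by rewrite invf_ple ?posrE// ltW// truncnS_gt.
move=> k; split; first exact: measurableU.
apply: (@le_lt_trans _ _ (nu (far k) + nu [set 0%R])%E).
  exact: measureU2.
rewrite nu0 adde0.
have h : (k.+1%:R^-1%:E * nu (far k) < +oo)%E.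
  apply: le_lt_trans nufin; rewrite -integral_cst//.
  apply: (@le_trans _ _ (\int[nu]_(y in far k) (Num.min 1 (enorm y ^+ 2))%:E)%E).
    exact: le_integral_pointwise.
  apply: ge0_subset_integral => //.
    by apply/measurable_EFinP; exact: measurable_levy_weight.
  by move=> y _; rewrite lee_fin le_min ler01 sqr_ge0.
rewrite ltey; apply/eqP => nuoo; move: h.
by rewrite nuoo gt0_muley ?lte_fin// ltxx.
Qed.

(** The value at [t e_i] of the Fourier symbol of the operator attached to
    [nu]. *)
Definition cos_symbol nu (t : R) (i : 'I_n.+1) : \bar R :=
  (\int[nu]_h (1 - cos (t * h 0 i))%:E)%E.

Lemma measurable_cos_coord t (i : 'I_n.+1) :
  measurable_fun [set: E] (fun y : E => cos (t * y 0 i)).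
Proof.
apply: (measurableT_comp (@continuous_measurable_fun R cos _)).
  exact: continuous_cos.
exact: measurable_funM (measurable_coord i).
Qed.

Lemma measurable_onem_cos t (i : 'I_n.+1) :
  measurable_fun [set: E] (fun h : E => (1 - cos (t * h 0 i))%:E).
Proof.
apply/measurable_EFinP; apply: measurable_funB => //.
exact: measurable_cos_coord.
Qed.

(** [1 - cos s <= min (2, s^2 / 2)], and [|t * h_i| <= |h|]. *)
Lemma cos_symbol_lty nu t i : symmetric_levy nu ->
  `|t| <= 1 -> (cos_symbol nu t i < +oo)%E.
Proof.
move=> [_ _ nufin] t1.
apply: (@le_lt_trans _ _ (2%:E * \int[nu]_y (Num.min 1 (enorm y ^+ 2))%:E)%E).
  rewrite -ge0_integralZl//; first last.
  - by move=> y _; rewrite lee_fin le_min ler01 sqr_ge0.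
  - by apply/measurable_EFinP; exact: measurable_levy_weight.
  apply: le_integral_pointwise => y _; rewrite -EFinM lee_fin.
  have := onem_cos_le (t * y 0 i); have := cos_geN1 (t * y 0 i).
  have := ler_coord_enorm2 y i; rewrite exprMn.
  have : t ^+ 2 <= 1 by rewrite -real_normK ?num_real// expr_le1.
  have := sqr_ge0 (y 0 i).
  move: (y 0 i ^+ 2) (t ^+ 2) (cos _) (enorm y ^+ 2) => a b c d.
  by rewrite minEle; case: ifPn => _; nra.
by rewrite lte_mul_pinfty.
Qed.

(** The sets [0 < |y_i| <= k] cover everything but the origin, so one of them is
    charged by [nu]; for [t <= 1 / (k + 1)] the integrand is positive on it,
    since [0 < |t y_i| <= 1] there. *)
Lemma cos_symbol_gt0 nu : nu [set 0] = 0%E ->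
  (exists2 A : set E, measurable A & nu A <> 0%E) ->
  exists i, exists2 m : R, 0 < m &
    forall t, 0 < t <= m -> (0 < cos_symbol nu t i)%E.
Proof.
move=> nu0 [A mA nuA].
pose B i k := [set y : E | 0 < `|y 0 i| <= k%:R].
have mB i k : measurable (B i k).
  rewrite -[X in measurable X]setTI.
  rewrite (_ : B i k = (fun y : E => `|y 0 i|) @^-1` `]0, k%:R]).
    by apply: (measurableT_comp (@normr_measurable _ setT) (measurable_coord i)).
  by apply/seteqP; split=> y; rewrite /= in_itv/=.
have [i [k Bik]] : exists i k, nu (B i k) <> 0%E.
  apply: contrapT => /forallNP B0.
  apply: nuA; apply/(measure_negligible mA).
  have : nu.-negligible ([set 0] `|` \bigcup_j \bigcup_k B (inord j) k).
    apply: negligibleU; first by exists [set 0]; split => //; exact: measurable_row0.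
    apply: negligible_bigcup => j; apply: negligible_bigcup => k.
    exists (B (inord j) k); split => //; apply: contrapT => h.
    by apply: (B0 (inord j)); exists k.
  apply: negligibleS => y _ /=; have [->|y0] := eqVneq y 0; first by left.
  right; have [i yi] := row_neq0_coord y0; exists (nat_of_ord i) => //.
  exists (Num.truncn `|y 0 i|).+1 => //; rewrite /B /= inord_val normr_gt0 yi/=.
  exact/ltW/truncnS_gt.
exists i, (k.+1%:R^-1) => // t /andP[t0 tk].
rewrite lt0e; apply/andP; split; last first.
  by apply: integral_ge0 => h _; rewrite lee_fin onem_cos_ge0.
apply/eqP => psi0; apply: Bik; apply/(measure_negligible (mB _ _)).
have mf := measurable_onem_cos t i.
have : (\int[nu]_h `|(1 - cos (t * h 0 i))%:E|)%E = 0%E.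
  rewrite -psi0; apply: eq_integral => h _.
  by rewrite gee0_abs// lee_fin onem_cos_ge0.
move/(ae_eq_integral_abs nu measurableT mf).1; apply: negligibleS => y /= By h.
case: (h Logic.I) => h0.
have /andP[y0 yk] := By.
have : 0 < `|t * y 0 i| <= 1.
  rewrite normrM (gtr0_norm t0) mulr_gt0//= -(@mulVf _ (k.+1%:R : R))//.
  apply: ler_pM => //; first exact: ltW.
  by rewrite (le_trans yk)// ler_nat.
by move/onem_cos_gt0; rewrite h0 ltxx.
Qed.

End levy_measure.

(** * Increments and the jump measure *)

Section increments.
Context (R : realType) (n : nat).
Local Notation E := 'rV[R]_n.+1.
Local Notation leb := (@lebesgue_rV R n).
Implicit Types (u w phi : E -> R) (D : set E).

Definition increment u (p : E * E) : R := u (p.1 + p.2) - u p.1.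

Lemma measurable_increment u :
  measurable_fun [set: E] u -> measurable_fun [set: E * E] (increment u).
Proof.
move=> mu; apply: measurable_funB; last exact: measurableT_comp mu _.
exact: (measurableT_comp mu (@measurable_rowD R n)).
Qed.

Lemma measurable_shift (h : E) : measurable_fun [set: E] (fun y => y + h).
Proof.
exact: (measurable_fun_pair1 h (@measurable_rowD R n)).
Qed.

Lemma integral_shift (h : E) (F : E -> \bar R) :
  measurable_fun [set: E] F ->
  (\int[leb]_y F (y + h)%R = \int[leb]_y F y)%E.
Proof.
move=> mF; apply: (@integral_image_measure _ _ _ _ _ leb leb _ F) mF => //.
  exact: measurable_shift.
by move=> A _; exact: lebesgue_rV_shift.
Qed.

Lemma integral_levy_shift (nu : {measure set E -> \bar R}) (y : E)
    (F : E -> \bar R) :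
  measurable_fun [set: E] F ->
  (\int[levy_shift nu y]_x F x = \int[nu]_h F (y + h)%R)%E.
Proof.
move=> mF; apply/esym.
apply: (@integral_image_measure _ _ _ _ _ nu (levy_shift nu y) _ F) mF => //.
exact: (measurable_fun_pair2 y (@measurable_rowD R n)).
Qed.

Lemma integral_opp (nu : {measure set E -> \bar R}) (F : E -> \bar R) :
  symmetric_levy nu -> measurable_fun [set: E] F ->
  (\int[nu]_h F (- h)%R = \int[nu]_h F h)%E.
Proof.
move=> [_ nuN _] mF.
apply: (@integral_image_measure _ _ _ _ _ nu nu _ F) mF => //.
  exact: measurable_rowN.
move=> A mA; rewrite -(nuN A mA); congr (nu _).
apply/seteqP; split=> [x Ax|_ [x Ax <-]] /=; last by rewrite opprK.
by exists (- x) => //; rewrite opprK.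
Qed.

Section sigma_finite.
Variable nu : {sigma_finite_measure set E -> \bar R}.
Hypothesis nu_levy : symmetric_levy nu.

(** Reversing a jump, [(y, h) -> (y + h, - h)], preserves the product of
    Lebesgue measure and [nu]: first translate [y] at fixed [h], then reflect
    [h] at fixed [y]. *)
Lemma integral_jump_reversal (F : E * E -> \bar R) :
  measurable_fun [set: E * E] F -> (forall p, 0 <= F p)%E ->
  (\int[leb]_y \int[nu]_h F (y + h, - h)%R =
   \int[leb]_y \int[nu]_h F (y, h))%E.
Proof.
move=> mF F0.
have mF1 : measurable_fun [set: E * E] (fun p => F (p.1 + p.2, - p.2)).
  apply: (measurableT_comp mF); apply: measurable_fun_pair => /=.
    exact: measurable_rowD.
  exact: (measurableT_comp (@measurable_rowN R n)).
have mF2 : measurable_fun [set: E * E] (fun p => F (p.1, - p.2)).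
  apply: (measurableT_comp mF); apply: measurable_fun_pair => //=.
  exact: (measurableT_comp (@measurable_rowN R n)).
rewrite (fubini_tonelli (m1 := leb) (m2 := nu) _ mF1)//=.
under eq_integral => h _.
  rewrite (@integral_shift h (fun y => F (y, - h)))/=; last first.
    exact: measurable_fun_pair1.
  over.
rewrite -(fubini_tonelli (m1 := leb) (m2 := nu) _ mF2)//=.
apply: eq_integral => y _; apply: (@integral_opp nu (fun h => F (y, h))) => //.
exact: measurable_fun_pair2.
Qed.

(** The product vanishes unless [phi] is nonzero at one of the endpoints [y] and
    [y + h]. Pairs with [phi y != 0] are controlled by the energies over [D], as
    [phi] vanishes almost everywhere outside; pairs with [phi (y + h) != 0] are
    the reversed ones, and the energy density is invariant under reversal. *)
Lemma integrable_increment_product D w phi :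
  measurable D -> measurable_fun [set: E] w -> measurable_fun [set: E] phi ->
  {ae leb, forall x, (~` D) x -> phi x = 0} ->
  (\int[leb]_(y in D) \int[nu]_h (increment w (y, h) ^+ 2)%:E < +oo)%E ->
  (\int[leb]_(y in D) \int[nu]_h (increment phi (y, h) ^+ 2)%:E < +oo)%E ->
  (leb \x nu)%E.-integrable [set: E * E]
    (fun p => (increment w p * increment phi p)%:E).
Proof.
move=> mD mw mphi phi0 wfin phifin.
have mdw := measurable_increment mw; have mdphi := measurable_increment mphi.
have mdw2 := measurable_funX 2 mdw; have mdphi2 := measurable_funX 2 mdphi.
pose S p : \bar R := (increment w p ^+ 2 + increment phi p ^+ 2)%:E.
have mS : measurable_fun [set: E * E] S.
  by apply/measurable_EFinP; exact: measurable_funD.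
have S0 p : (0 <= S p)%E by rewrite lee_fin addr_ge0// sqr_ge0.
pose A := [set y | phi y != 0].
have mA : measurable A.
  rewrite -[X in measurable X]setTI (_ : A = phi @^-1` (~` [set 0])).
    by apply: mphi => //; exact: measurableC.
  by apply/seteqP; split=> y /= /eqP.
(* [F] keeps the pairs that start where [phi] is nonzero, and [F'] below the
   pairs that end there. *)
pose F p := (S p * (\1_A p.1)%:E)%E.
have mF : measurable_fun [set: E * E] F.
  apply: emeasurable_funM => //; apply/measurable_EFinP.
  have m1A : measurable_fun [set: E] (\1_A : E -> R) by exact: measurable_indic.
  exact: (measurableT_comp m1A measurable_fst).
have F0 p : (0 <= F p)%E by rewrite mule_ge0// lee_fin.
have mSh y : measurable_fun [set: E] (fun h => S (y, h)).
  exact: measurable_fun_pair2.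
have Ffin : (\int[leb]_y \int[nu]_h F (y, h) < +oo)%E.
  have -> : (\int[leb]_y \int[nu]_h F (y, h) =
             \int[leb]_y ((\int[nu]_h S (y, h)) * (\1_A y)%:E))%E.
    by apply: eq_integral => y _; rewrite /F /= ge0_integralZr//.
  have mG : measurable_fun [set: E] (fun y => \int[nu]_h S (y, h))%E.
    exact: (measurable_fun_fubini_tonelli_F (m2 := nu) S).
  apply: (@le_lt_trans _ _ (\int[leb]_y ((\int[nu]_h S (y, h)) * (\1_D y)%:E))%E).
    apply: ae_ge0_le_integral => //.
    - by move=> y _; rewrite mule_ge0// ?lee_fin// integral_ge0.
    - apply: emeasurable_funM => //; apply/measurable_EFinP.
      exact: measurable_indic.
    - by move=> y _; rewrite mule_ge0// ?lee_fin// integral_ge0.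
    - apply: emeasurable_funM => //; apply/measurable_EFinP.
      exact: measurable_indic.
    apply: filterS phi0 => y phiy _; apply: lee_wpmul2l; first exact: integral_ge0.
    rewrite lee_fin !indicE; case: (boolP (y \in D)) => [_|yD].
      by case: (y \in A).
    rewrite memNset//= /A /= phiy ?eqxx// => Dy.
    by rewrite mem_set in yD.
  have -> : (fun y => (\int[nu]_h S (y, h)) * (\1_D y)%:E)%E =
      ((fun y => \int[nu]_h S (y, h)) \_ D)%E by rewrite epatch_indic.
  rewrite -integral_mkcond.
  have SE y : (\int[nu]_h S (y, h) =
      \int[nu]_h (increment w (y, h) ^+ 2)%:E +
      \int[nu]_h (increment phi (y, h) ^+ 2)%:E)%E.
    under eq_integral do rewrite /S EFinD.
    rewrite ge0_integralD//.
    - by move=> h _; rewrite lee_fin sqr_ge0.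
    - by apply/measurable_EFinP; exact: measurable_fun_pair2 mdw2.
    - by move=> h _; rewrite lee_fin sqr_ge0.
    - by apply/measurable_EFinP; exact: measurable_fun_pair2 mdphi2.
  under eq_integral do rewrite SE.
  rewrite ge0_integralD//.
  - exact: lte_add_pinfty.
  - by move=> y _; apply: integral_ge0 => h _; rewrite lee_fin sqr_ge0.
  - apply: measurable_funTS.
    apply: (measurable_fun_fubini_tonelli_F (m2 := nu)
      (fun p => (increment w p ^+ 2)%:E)).
      exact/measurable_EFinP.
    by move=> p; rewrite lee_fin sqr_ge0.
  - by move=> y _; apply: integral_ge0 => h _; rewrite lee_fin sqr_ge0.
  - apply: measurable_funTS.
    apply: (measurable_fun_fubini_tonelli_F (m2 := nu)
      (fun p => (increment phi p ^+ 2)%:E)).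
      exact/measurable_EFinP.
    by move=> p; rewrite lee_fin sqr_ge0.
have mW : measurable_fun [set: E * E]
    (fun p => (increment w p * increment phi p)%:E).
  by apply/measurable_EFinP; exact: measurable_funM.
apply/(integrable12ltyP leb nu mW) => /=.
pose F' p := F (p.1 + p.2, - p.2).
have mF' : measurable_fun [set: E * E] F'.
  apply: (measurableT_comp mF); apply: measurable_fun_pair => /=.
    exact: measurable_rowD.
  exact: (measurableT_comp (@measurable_rowN R n)).
apply: (@le_lt_trans _ _ (\int[leb]_y \int[nu]_h (F (y, h) + F' (y, h)))%E).
  apply: le_integral_pointwise => y _; apply: le_integral_pointwise => h _.
  have SE : S (y + h, - h) = S (y, h).
    by rewrite /S /increment/= addrK; congr (_%:E); ring.
  rewrite /F' /F /= SE -muleDr//.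
  rewrite -EFinD -EFinM lee_fin !indicE.
  have Wle : `|increment w (y, h) * increment phi (y, h)| <=
      increment w (y, h) ^+ 2 + increment phi (y, h) ^+ 2.
    rewrite ler_norml; move: (increment w _) (increment phi _) => a b.
    by apply/andP; split; have := sqr_ge0 (a + b); have := sqr_ge0 (a - b);
      have := sqr_ge0 a; have := sqr_ge0 b; nra.
  have S1 := sqr_ge0 (increment w (y, h)).
  have S2 := sqr_ge0 (increment phi (y, h)).
  case: (boolP (y \in A)) => [_|/negP yA];
    case: (boolP (y + h \in A)) => [_|/negP yhA];
    rewrite /= ?addr0 ?add0r ?mulr1//.
  - by apply: (le_trans Wle); nra.
  - have -> : increment phi (y, h) = 0.
      rewrite /increment/=; move: yA yhA; rewrite !inE /A /=.
      by move=> /negP/negPn/eqP -> /negP/negPn/eqP ->; rewrite subr0.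
    by rewrite mulr0 normr0 mulr0.
have -> : (\int[leb]_y \int[nu]_h (F (y, h) + F' (y, h)) =
  \int[leb]_y (\int[nu]_h F (y, h) + \int[nu]_h F' (y, h)))%E.
  apply: eq_integral => y _; rewrite ge0_integralD//.
  - exact: measurable_fun_pair2.
  - by move=> h _; exact: F0.
  - exact: measurable_fun_pair2.
rewrite ge0_integralD//.
- by rewrite integral_jump_reversal//; exact: lte_add_pinfty.
- by move=> y _; exact: integral_ge0.
- exact: (measurable_fun_fubini_tonelli_F (m2 := nu) F).
- by move=> y _; apply: integral_ge0 => h _; exact: F0.
- by apply: (measurable_fun_fubini_tonelli_F (m2 := nu) F') => // p; exact: F0.
Qed.

End sigma_finite.

End increments.

(** * The cosine wave as an eigenfunction *)

Section cosine_wave.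
Context (R : realType) (n : nat).
Local Notation E := 'rV[R]_n.+1.
Local Notation leb := (@lebesgue_rV R n).
Variables (k t : R) (i : 'I_n.+1).

Definition cosine_wave (y : E) : R := k * cos (t * y 0 i).
Local Notation w := cosine_wave.

Lemma measurable_cosine_wave : measurable_fun [set: E] w.
Proof. by apply: measurable_funM => //; exact: measurable_cos_coord. Qed.

Lemma norm_cosine_wave_le y : `|w y| <= `|k|.
Proof. by rewrite normrM ler_piMr// cos_max. Qed.

Lemma cosine_wave_second_difference (y h : E) :
  w (y + h) + w (y - h) = w y * cos (t * h 0 i) *+ 2.
Proof. by rewrite /w !mxE mulrDr mulrBr cosD cosB; ring. Qed.

Lemma sqr_increment_cosine_wave_le (y h : E) :
  increment w (y, h) ^+ 2 <= k ^+ 2 * 2 * (1 - cos (t * h 0 i)).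
Proof.
rewrite /increment/= /w -mulrBr exprMn -mulrA ler_wpM2l ?sqr_ge0//.
by rewrite !mxE mulrDr mulr_natl; exact: sqr_cos_increment_le.
Qed.

(** Summation by parts: with [a y = w y - w (y - h)] and [b y = w y - w (y + h)]
    the integrand is [(a phi) (y + h) + (b phi) y], so translation invariance
    turns its integral into that of [(a + b) phi], and [a + b] is minus the
    second difference of [w]. *)
Lemma integral_cosine_wave_increment (h : E) (phi : E -> R) :
  leb.-integrable [set: E] (EFin \o phi) ->
  (\int[leb]_y (increment w (y, h) * increment phi (y, h))%:E =
   (2 * (1 - cos (t * h 0 i)))%:E * \int[leb]_y (w y * phi y)%:E)%E.
Proof.
move=> iphi.
have mphi : measurable_fun [set: E] phi.
  by apply/measurable_EFinP; exact: measurable_int iphi.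
have mw := measurable_cosine_wave.
have iM c (a : E -> R) : measurable_fun [set: E] a -> (forall y, `|a y| <= c) ->
    leb.-integrable [set: E] (fun y => (a y * phi y)%:E).
  move=> ma ac.
  apply: (@le_integrable _ _ _ leb _ _ _
    (fun y => (c%:E * (phi y)%:E)%E)) => //.
  - by apply/measurable_EFinP; exact: measurable_funM.
  - move=> y _; rewrite /= lee_fin !normrM ler_wpM2r//.
    by rewrite (le_trans (ac y))// ler_norm.
  - exact: integrableZl.
pose a y := w y - w (y - h).
pose b y := w y - w (y + h).
have mws g : measurable_fun [set: E] (fun y => w (y + g)).
  exact: measurableT_comp mw (@measurable_shift _ _ g).
have ia : leb.-integrable [set: E] (fun y => (a y * phi y)%:E).
  apply: (iM (`|k| + `|k|)) => [|y]; first exact: measurable_funB.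
  by rewrite (le_trans (ler_normB _ _))// lerD// norm_cosine_wave_le.
have ib : leb.-integrable [set: E] (fun y => (b y * phi y)%:E).
  apply: (iM (`|k| + `|k|)) => [|y]; first exact: measurable_funB.
  by rewrite (le_trans (ler_normB _ _))// lerD// norm_cosine_wave_le.
have iw : leb.-integrable [set: E] (fun y => (w y * phi y)%:E).
  by apply: (iM `|k|) => // y; exact: norm_cosine_wave_le.
have mah := measurable_int leb ia.
have ias : leb.-integrable [set: E] (fun y => (a (y + h) * phi (y + h))%:E).
  apply/integrableP; split.
    exact: (measurableT_comp mah (@measurable_shift _ _ h)).
  rewrite (@integral_shift _ _ h (fun y => `|(a y * phi y)%:E|)%E).
    by case/integrableP : ia.
  exact: measurableT_comp mah.
transitivity (\int[leb]_y ((a (y + h)%R * phi (y + h)%R)%:E + (b y * phi y)%:E))%E.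
  apply: eq_integral => y _; rewrite -EFinD; congr (_%:E).
  by rewrite /a /b /increment/= addrK; ring.
rewrite integralD//.
rewrite (@integral_shift _ _ h (fun y => (a y * phi y)%:E)%E)//.
rewrite -integralD// -integralZl//.
apply: eq_integral => y _; rewrite -EFinD -EFinM; congr (_%:E).
have := cosine_wave_second_difference y h; rewrite /a /b -mulrDl => wE.
rewrite (_ : w y - _ + _ = w y *+ 2 - (w (y + h) + w (y - h))); last by ring.
by rewrite wE; ring.
Qed.

(** The weak form of the eigenvalue equation: twice the energy of [(w, phi)] is
    twice the symbol times the integral of [w phi]. *)
Lemma cosine_wave_energy (nu : {sigma_finite_measure set E -> \bar R})
    (phi : E -> R) :
  (cos_symbol nu t i < +oo)%E ->
  leb.-integrable [set: E] (EFin \o phi) ->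
  (leb \x nu)%E.-integrable [set: E * E]
    (fun p => (increment w p * increment phi p)%:E) ->
  (\int[leb]_y \int[nu]_h (increment w (y, h) * increment phi (y, h))%:E =
   2%:E * cos_symbol nu t i * \int[leb]_y (w y * phi y)%:E)%E.
Proof.
move=> psi_fin iphi iW; rewrite (Fubini iW)/=.
under eq_integral do rewrite integral_cosine_wave_increment//.
have mc := measurable_onem_cos t i.
have ic : nu.-integrable [set: E] (fun h : E => (1 - cos (t * h 0 i))%:E).
  apply/integrableP; split => //; apply: le_lt_trans psi_fin.
  by apply: le_integral_pointwise => h _; rewrite gee0_abs// lee_fin onem_cos_ge0.
have Ifin : (\int[leb]_y (w y * phi y)%:E)%E \is a fin_num.
  have mphi : measurable_fun [set: E] phi.
    by apply/measurable_EFinP; exact: measurable_int iphi.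
  apply: integrable_fin_num => //.
  apply: (@le_integrable _ _ _ leb _ _ _ (fun y => (k%:E * (phi y)%:E)%E)) => //.
  - apply/measurable_EFinP; apply: measurable_funM => //; exact: measurable_cosine_wave.
  - move=> y _; rewrite /= lee_fin !normrM ler_wpM2r// -normrM.
    exact: norm_cosine_wave_le.
  - exact: integrableZl.
rewrite -(fineK Ifin) integralZr//; last first.
  by under eq_fun do rewrite EFinM; exact: integrableZl.
by congr (_ * _)%E; under eq_integral do rewrite EFinM; rewrite integralZl.
Qed.

End cosine_wave.

(** * Comparison with the barrier *)

(** The positive part is nondecreasing and 1-Lipschitz, in a single inequality:
    it makes the form of [(u - b, phi)] nonnegative, and bounds the energy of
    [phi] by that of [u - b]. *)
Lemma sqr_pos_part_increment_le (R : realDomainType) (a b : R) :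
  (Num.max 0 a - Num.max 0 b) ^+ 2 <= (a - b) * (Num.max 0 a - Num.max 0 b).
Proof.
rewrite expr2 -subr_ge0 -mulrBl !maxEle.
case: (leP 0 a) => a0; case: (leP 0 b) => b0; rewrite ?subrr ?mulr0 ?mul0r//.
- by rewrite subr0 mulr_ge0//; lra.
- by rewrite sub0r mulr_le0//; lra.
Qed.

Section comparison.
Context (R : realType) (n : nat).
Local Notation E := 'rV[R]_n.+1.
Local Notation leb := (@lebesgue_rV R n).
Implicit Types (u phi : E -> R) (D : set E).

Lemma levy_formE (nu : {measure set E -> \bar R}) u phi :
  measurable_fun [set: E] u -> measurable_fun [set: E] phi ->
  (\int[leb]_y \int[levy_shift nu y]_x
     ((u x - u y) * (phi x - phi y))%:E =
   \int[leb]_y \int[nu]_h (increment u (y, h) * increment phi (y, h))%:E)%E.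
Proof.
move=> mu mphi; apply: eq_integral => y _; apply: integral_levy_shift.
by apply/measurable_EFinP; apply: measurable_funM; exact: measurable_funB.
Qed.

Lemma VspaceP (nu : {measure set E -> \bar R}) D u :
  Vspace nu D u <->
  [/\ measurable_fun [set: E] u, (\int[leb]_(x in D) (u x ^+ 2)%:E < +oo)%E &
      (\int[leb]_(y in D) \int[nu]_h (increment u (y, h) ^+ 2)%:E < +oo)%E].
Proof.
have E2 : measurable_fun [set: E] u ->
    (\int[leb]_(y in D) \int[levy_shift nu y]_x ((u x - u y) ^+ 2)%:E =
     \int[leb]_(y in D) \int[nu]_h (increment u (y, h) ^+ 2)%:E)%E.
  move=> mu; apply: eq_integral => y _.
  apply: (@integral_levy_shift _ _ nu y (fun x => ((u x - u y) ^+ 2)%:E)).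
  by apply/measurable_EFinP; apply: measurable_funX; exact: measurable_funB.
have g0 : (0 <= \int[leb]_(x in D) (u x ^+ 2)%:E)%E.
  by apply: integral_ge0 => x _; rewrite lee_fin sqr_ge0.
have e0 : (0 <= \int[leb]_(y in D) \int[nu]_h (increment u (y, h) ^+ 2)%:E)%E.
  by apply: integral_ge0 => y _; apply: integral_ge0 => h _; rewrite lee_fin sqr_ge0.
split=> [[mu]|[mu uD eD]]; last first.
  by split => //; rewrite E2//; apply: lte_add_pinfty => //; rewrite lte_mul_pinfty.
rewrite E2// => fin; split => //.
  by apply: le_lt_trans fin; rewrite leeDl// mule_ge0// lee_fin invr_ge0.
rewrite ltey; apply/eqP => eoo; move: fin; rewrite eoo.
by rewrite gt0_muley ?lte_fin ?invr_gt0// addey ?ltxx// gt_eqF// (lt_le_trans _ g0).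
Qed.

Lemma HspaceN (nu : {measure set E -> \bar R}) D u :
  Hspace nu D u -> Hspace nu D (fun x => - u x).
Proof.
move=> [/VspaceP[mu uD eD] u0]; split; last first.
  by apply: filterS u0 => x ux /ux ->; rewrite oppr0.
apply/VspaceP; split; first exact: measurableT_comp.
  by under eq_integral do rewrite sqrrN.
under eq_integral do under eq_integral do
  rewrite /increment/= -opprD sqrrN.
exact: eD.
Qed.

Lemma weak_solutionN (nu : {measure set E -> \bar R}) D f g u :
  weak_solution nu D f g u ->
  weak_solution nu D (fun x => - f x) (fun x => - g x) (fun x => - u x).
Proof.
move=> [/VspaceP[mu uD eD] ug weak]; split.
- apply/VspaceP; split; first exact: measurableT_comp.
    by under eq_integral do rewrite sqrrN.
  under eq_integral do under eq_integral do
    rewrite /increment/= -opprD sqrrN.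
  exact: eD.
- by apply: filterS ug => x ux /ux ->.
- move=> phi /HspaceN/weak;
  under [in X in _ = X]eq_integral do rewrite mulrN -mulNr.
  move=> <-; congr (_ * _)%E; apply: eq_integral => y _; apply: eq_integral => x _.
  by congr (_%:E); ring.
Qed.

Section sigma_finite.
Variable nu : {sigma_finite_measure set E -> \bar R}.
Hypothesis nu_levy : symmetric_levy nu.
Variables (D : set E) (t : R) (i : 'I_n.+1) (psi : R).
Hypothesis mD : measurable D.
Hypothesis Dfin : (leb D < +oo)%E.
Hypothesis psiE : cos_symbol nu t i = psi%:E.
Hypothesis cosD_ge : forall x, D x -> 2^-1 <= cos (t * x 0 i).

Lemma cosine_wave_finite_energy k :
  (\int[leb]_(y in D) \int[nu]_h (increment (cosine_wave k t i) (y, h) ^+ 2)%:E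
   < +oo)%E.
Proof.
have mc := measurable_onem_cos t i.
apply: (@le_lt_trans _ _ (\int[leb]_(y in D) (k ^+ 2 * 2 * psi)%:E)%E).
  apply: le_integral_pointwise => y _; rewrite EFinM -psiE.
  rewrite -ge0_integralZl//; last by rewrite lee_fin mulr_ge0// sqr_ge0.
  apply: le_integral_pointwise => h _; rewrite -EFinM lee_fin.
  exact: sqr_increment_cosine_wave_le.
have psi0 : 0 <= psi.
  by rewrite -lee_fin -psiE integral_ge0// => h _; rewrite lee_fin onem_cos_ge0.
rewrite integral_cst//; apply: lte_mul_pinfty => //.
by rewrite lee_fin mulr_ge0// mulr_ge0// sqr_ge0.
Qed.

Lemma finite_energy_dominated u v phi :
  measurable_fun [set: E] u -> measurable_fun [set: E] v ->
  (forall p, increment phi p ^+ 2 <=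
     2 * increment u p ^+ 2 + 2 * increment v p ^+ 2) ->
  (\int[leb]_(y in D) \int[nu]_h (increment u (y, h) ^+ 2)%:E < +oo)%E ->
  (\int[leb]_(y in D) \int[nu]_h (increment v (y, h) ^+ 2)%:E < +oo)%E ->
  (\int[leb]_(y in D) \int[nu]_h (increment phi (y, h) ^+ 2)%:E < +oo)%E.
Proof.
move=> mu mv dom ufin vfin.
pose e a y := (\int[nu]_h (increment a (y, h) ^+ 2)%:E)%E.
have m2 a : measurable_fun [set: E] a ->
    measurable_fun [set: E * E] (fun p => (increment a p ^+ 2)%:E).
  move=> ma; apply/measurable_EFinP; apply: measurable_funX.
  exact: measurable_increment.
have me a : measurable_fun [set: E] a -> measurable_fun [set: E] (e a).
  move=> ma; apply: (measurable_fun_fubini_tonelli_F (m2 := nu)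
    (fun p => (increment a p ^+ 2)%:E)); first exact: m2.
  by move=> p; rewrite lee_fin sqr_ge0.
have e0 a y : (0 <= e a y)%E.
  by apply: integral_ge0 => h _; rewrite lee_fin sqr_ge0.
apply: (@le_lt_trans _ _ (\int[leb]_(y in D) (2%:E * e u y + 2%:E * e v y))%E).
  apply: le_integral_pointwise => y _.
  rewrite -!ge0_integralZl//; first last.
  - by move=> h _; rewrite lee_fin sqr_ge0.
  - exact: measurable_fun_pair2 (m2 _ mu).
  - by move=> h _; rewrite lee_fin sqr_ge0.
  - exact: measurable_fun_pair2 (m2 _ mv).
  rewrite -ge0_integralD//; first last.
  - by apply: emeasurable_funM => //; exact: measurable_fun_pair2 (m2 _ mv).
  - by move=> h _; rewrite -EFinM lee_fin mulr_ge0// sqr_ge0.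
  - by apply: emeasurable_funM => //; exact: measurable_fun_pair2 (m2 _ mu).
  - by move=> h _; rewrite -EFinM lee_fin mulr_ge0// sqr_ge0.
  apply: le_integral_pointwise => h _; rewrite -!EFinM -EFinD lee_fin.
  exact: dom.
have meD a : measurable_fun [set: E] a -> measurable_fun D (e a).
  by move=> ma; apply: measurable_funTS; exact: me.
rewrite ge0_integralD//; first last.
- by apply: emeasurable_funM => //; exact: meD.
- by move=> y _; rewrite mule_ge0.
- by apply: emeasurable_funM => //; exact: meD.
- by move=> y _; rewrite mule_ge0.
rewrite !ge0_integralZl//; [|exact: meD|exact: meD].
by apply: lte_add_pinfty; rewrite lte_mul_pinfty.
Qed.

(** The comparison principle for the barrier [k (1 + cos (t * x_i)) + N]; adding
    [1] to the cosine makes it at least [N] everywhere. The strict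
    inequality between [M] and [k * psi / 2] is what forces the test function to
    vanish. *)
Lemma weak_subsolution_bound (k M N : R) (f u : E -> R) :
  0 <= k -> 0 <= M -> 0 <= N -> M < k * psi / 2 ->
  measurable_fun D f -> {ae leb, forall x, D x -> `|f x| <= M} ->
  Vspace nu D u -> {ae leb, forall x, (~` D) x -> u x <= N} ->
  (forall phi, Hspace nu D phi ->
     (2^-1%:E * \int[leb]_y \int[levy_shift nu y]_x
        ((u x - u y) * (phi x - phi y))%:E =
      \int[leb]_(x in D) (f x * phi x)%:E)%E) ->
  {ae leb, forall x, D x -> u x <= 2 * k + N}.
Proof.
move=> k0 M0 N0 Mk mf fM /VspaceP[mu uD eD] uN weak.
pose w := cosine_wave k t i.
have mw : measurable_fun [set: E] w by exact: measurable_cosine_wave.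
have wk x : - k <= w x <= k.
  by have := norm_cosine_wave_le k t i x; rewrite (ger0_norm k0) ler_norml.
pose z x := u x - (k + w x + N).
pose phi x : R := Num.max 0 (z x).
have mz : measurable_fun [set: E] z.
  apply: measurable_funB => //; apply: measurable_funD => //.
  exact: measurable_funD.
have mphi : measurable_fun [set: E] phi by exact: measurable_maxr.
have phi_ge0 x : 0 <= phi x by rewrite le_max lexx.
have phi_le x : phi x <= `|u x|.
  rewrite ge_max normr_ge0/= (le_trans _ (ler_norm _))// /z.
  have := wk x; lra.
have phi_sqr x : phi x ^+ 2 <= u x ^+ 2.
  by rewrite -[leRHS]real_normK ?num_real// ler_sqr ?nnegrE.
have dphi p : increment phi p ^+ 2 <= increment z p * increment phi p.
  exact: sqr_pos_part_increment_le.
have dz p : increment z p = increment u p - increment w p.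
  by rewrite /increment /z; ring.
have phi_energy :
    (\int[leb]_(y in D) \int[nu]_h (increment phi (y, h) ^+ 2)%:E < +oo)%E.
  apply: (finite_energy_dominated mu mw) => [p||].
  - have := dphi p; rewrite dz.
    move: (increment u p) (increment w p) (increment phi p) => a b c cab.
    by have := sqr_ge0 (a + b); have := sqr_ge0 (a - b - c); nra.
  - exact: eD.
  - exact: cosine_wave_finite_energy.
have phi0 : {ae leb, forall x, (~` D) x -> phi x = 0}.
  apply: filterS uN => x ux /ux uxN; rewrite /phi; apply/max_idPl.
  by rewrite /z; have := wk x; lra.
have phiL2 : (\int[leb]_(x in D) (phi x ^+ 2)%:E < +oo)%E.
  by apply: le_lt_trans uD; apply: le_integral_pointwise => x _; rewrite lee_fin.
have phiH : Hspace nu D phi by split => //; apply/VspaceP.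
pose J := (\int[leb]_(x in D) (phi x)%:E)%E.
have J0 : (0 <= J)%E by apply: integral_ge0 => x _; rewrite lee_fin.
have Jfin : (J < +oo)%E.
  (* [D] has finite measure, so square integrability gives integrability. *)
  apply: (@le_lt_trans _ _ (\int[leb]_(x in D) (1 + (phi x ^+ 2)%:E))%E).
    apply: le_integral_pointwise => x _; rewrite -EFinD lee_fin.
    have := sqr_ge0 (phi x - 1); nra.
  rewrite ge0_integralD//; first last.
  - by apply: measurable_funTS; apply/measurable_EFinP; exact: measurable_funX.
  - by move=> x _; rewrite lee_fin sqr_ge0.
  by apply: lte_add_pinfty => //; rewrite integral_cst// mul1e.
have intphi : leb.-integrable [set: E] (EFin \o phi).
  apply/integrableP; split; first exact/measurable_EFinP.
  have -> : (\int[leb]_x `|(EFin \o phi) x| = J)%E.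
    rewrite /J [RHS]integral_mkcond.
    apply: ge0_ae_eq_integral => //.
    - by apply: measurableT_comp => //; exact/measurable_EFinP.
    - apply/(measurable_restrictT _ mD); apply: measurable_funTS.
      exact/measurable_EFinP.
    - by move=> x _; apply: erestrict_ge0 => y _; rewrite lee_fin.
    - apply: filterS phi0 => x px _; rewrite /= ger0_norm// patchE.
      case: ifPn => // /negP xD.
      by rewrite px// => Dx; apply: xD; rewrite inE.
  exact: Jfin.
have psi_fin : (cos_symbol nu t i < +oo)%E by rewrite psiE ltry.
have iW := integrable_increment_product nu_levy mD mw mphi phi0
  (cosine_wave_finite_energy k) phi_energy.
have waveE := cosine_wave_energy psi_fin intphi iW.
have upper : (\int[leb]_(x in D) (f x * phi x)%:E <= M%:E * J)%E.
  have mphiD' : measurable_fun D phi by exact: measurable_funTS.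
  apply: (@le_trans _ _ (\int[leb]_(x in D) (`|f x| * phi x)%:E)%E).
    apply: le_integral_pointwise => x _.
    by rewrite lee_fin ler_wpM2r// ler_norm.
  apply: (@le_trans _ _ (\int[leb]_(x in D) (M%:E * (phi x)%:E))%E).
    apply: ae_ge0_le_integral => //.
    - by move=> x _; rewrite lee_fin mulr_ge0.
    - apply/measurable_EFinP; apply: measurable_funM => //.
      exact: measurableT_comp.
    - by move=> x _; rewrite lee_fin mulr_ge0.
    - by apply/measurable_EFinP; exact: measurable_funM.
    - by apply: filterS fM => x /[apply] fxM; rewrite lee_fin ler_wpM2r.
  rewrite ge0_integralZl_EFin// => [x _|]; first by rewrite lee_fin.
  exact/measurable_EFinP.
have lower : ((k / 2)%:E * J <= \int[leb]_y (w y * phi y)%:E)%E.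
  have -> : (\int[leb]_y (w y * phi y)%:E = \int[leb]_(y in D) (w y * phi y)%:E)%E.
    rewrite [RHS]integral_mkcond; apply: ae_eq_integral => //.
    - by apply/measurable_EFinP; exact: measurable_funM.
    - apply/(measurable_restrictT _ mD); apply: measurable_funTS.
      by apply/measurable_EFinP; exact: measurable_funM.
    - apply: filterS phi0 => x px _; rewrite patchE; case: ifPn => // /negP xD.
      by rewrite px ?mulr0// => Dx; apply: xD; rewrite inE.
  rewrite -ge0_integralZl_EFin//; first last.
  - by rewrite divr_ge0.
  - by apply: measurable_funTS; apply/measurable_EFinP.
  - by move=> x _; rewrite lee_fin.
  apply: le_integral_pointwise => x Dx; rewrite -EFinM lee_fin ler_wpM2r//.
  by rewrite ler_wpM2l// cosD_ge.
have psi0 : 0 <= psi.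
  by rewrite -lee_fin -psiE integral_ge0// => h _; rewrite lee_fin onem_cos_ge0.
have chain : ((k * psi / 2)%:E * J <= M%:E * J)%E.
  apply: le_trans upper; rewrite -weak// levy_formE//.
  apply: (@le_trans _ _ (2^-1%:E * (2%:E * cos_symbol nu t i *
      \int[leb]_y (w y * phi y)%:E))%E).
    rewrite !muleA -EFinM mulVf// mul1e psiE.
    rewrite (_ : k * psi / 2 = psi * (k / 2)); last by ring.
    by rewrite EFinM -muleA lee_wpmul2l// lee_fin.
  rewrite -waveE lee_wpmul2l ?lee_fin ?invr_ge0//.
  apply: le_integral_pointwise => y _; apply: le_integral_pointwise => h _.
  by rewrite lee_fin -subr_ge0 -mulrBl -dz (le_trans _ (dphi _))// sqr_ge0.
have J_eq0 : J = 0%E.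
  have /fineK JE : J \is a fin_num by rewrite ge0_fin_numE.
  move: chain J0; rewrite -JE.
  rewrite -!EFinM !lee_fin => JM J0'; congr (_%:E); apply/eqP.
  by rewrite eq_le J0' andbT; nra.
have : (\int[leb]_(x in D) `|(phi x)%:E|)%E = 0%E.
  by rewrite -J_eq0; apply: eq_integral => x _; rewrite gee0_abs ?lee_fin.
have mphiE : measurable_fun D (EFin \o phi).
  by apply: measurable_funTS; apply/measurable_EFinP.
move/(ae_eq_integral_abs leb mD mphiE).1; apply: filterS => x /[apply] /= -[phix0].
have : z x <= 0 by rewrite -phix0 le_max lexx orbT.
by rewrite /z; have := wk x; lra.
Qed.

End sigma_finite.
End comparison.

Lemma Linfty_normP (R : realType) (n : nat) (D : set 'rV[R]_n.+1)
    (f : 'rV[R]_n.+1 -> R) (M : R) : 0 <= M ->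
  (Linfty_norm D f <= M%:E)%E <->
  {ae @lebesgue_rV R n, forall x, D x -> `|f x| <= M}.
Proof.
move=> M0; rewrite /Linfty_norm Lnorm.unlock.
have aeE : (ess_sup (@lebesgue_rV R n) (abse \o (EFin \o f \_ D)) <= M%:E)%E <->
    {ae @lebesgue_rV R n, forall x, D x -> `|f x| <= M}.
  split=> [/ess_supP|h]; last apply/ess_supP; [|move: h]; apply: filterS => x /=.
    by rewrite lee_fin patchE => + Dx; rewrite mem_set.
  by rewrite lee_fin patchE; case: ifPn => [/set_mem Dx /(_ Dx)//|_]; rewrite normr0.
case: ifPn => [_//|]; rewrite -leNgt => mu0; split=> // _.
exists [set: 'rV[R]_n.+1]; split => //; apply/eqP; rewrite eq_le mu0.
exact: measure_ge0.
Qed.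

Theorem lemma5p7 (R : realType) (n : nat)
    (nu : {measure set 'rV[R]_n.+1 -> \bar R}) (Omega : set 'rV[R]_n.+1)
    (nu_levy : symmetric_levy nu)
    (nu_neq0 : exists2 A : set 'rV[R]_n.+1, measurable A & nu A <> 0%E)
    (Omega_neq0 : Omega !=set0) (Omega_open : open Omega)
    (Omega_bounded : bounded_set Omega) :
  exists2 c : R, 0 < c &
    forall f g u : 'rV[R]_n.+1 -> R,
      L2on Omega f -> weak_solution nu Omega f g u ->
      (Linfty_norm Omega u <=
         c%:E * Linfty_norm Omega f + Linfty_norm (~` Omega) g)%E.
Proof.
have nu_sigma := levy_sigma_finite nu_levy.
pose nu' := HB.pack_for (SigmaFiniteMeasure.type 'rV[R]_n.+1 R) (Measure.sort nu)
  (isSFinite.Build _ _ _ _ (sfinite_measure_sigma_finite nu_sigma))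
  (isSigmaFinite.Build _ _ _ _ nu_sigma).
have [nu0 _ _] := nu_levy.
have mOmega : measurable Omega by exact: sub_sigma_algebra.
have Ofin := lebesgue_rV_bounded Omega_bounded.
have [i [m m0 symb_gt0]] := cos_symbol_gt0 nu0 nu_neq0.
have [B B1 OB] : exists2 B : R, 1 <= B & forall x, Omega x -> `|x| <= B.
  case: Omega_bounded => B [_ OB]; exists (`|B| + 1); first by rewrite lerDr.
  by apply: OB; rewrite (le_lt_trans (ler_norm _))// ltrDl.
have B0 : 0 < B by rewrite (lt_le_trans _ B1).
(* [t <= B^-1] keeps the phase [t * x_i] in [-1, 1] over [Omega], where the
   cosine is at least [1 - 1 / 2]; [t <= m] makes the symbol positive. *)
pose t := Num.min B^-1 m.
have t0 : 0 < t by rewrite lt_min invr_gt0 B0.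
have tB : t <= B^-1 by rewrite ge_min lexx.
have tm : t <= m by rewrite ge_min lexx orbT.
have t1 : `|t| <= 1 by rewrite (gtr0_norm t0) (le_trans tB)// invf_le1.
have cosO x : Omega x -> 2^-1 <= cos (t * x 0 i).
  move=> /OB xB; have := onem_cos_le (t * x 0 i).
  suff : (t * x 0 i) ^+ 2 <= 1 by lra.
  rewrite -real_normK ?num_real// expr_le1// normrM (gtr0_norm t0).
  rewrite -(@mulVf _ B) ?gt_eqF//; apply: ler_pM => //; first exact: ltW.
  exact: le_trans (ler_coord_norm x i) xB.
have symb0 := symb_gt0 t; rewrite t0 tm in symb0; have {}symb0 := symb0 isT.
have symb_fin := cos_symbol_lty i nu_levy t1.
pose psi := fine (cos_symbol nu t i).
have psiE : cos_symbol nu t i = psi%:E by rewrite fineK// ge0_fin_numE// ltW.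
have psi0 : 0 < psi by rewrite -lte_fin -psiE.
exists (4 / psi); first by rewrite divr_gt0.
move=> f g u [mf _] sol.
have c0 : 0 < 4 / psi by rewrite divr_gt0.
have fge0 : (0 <= Linfty_norm Omega f)%E by exact: Lnorm_ge0.
have gge0 : (0 <= Linfty_norm (~` Omega) g)%E by exact: Lnorm_ge0.
have [foo|] := eqVneq (Linfty_norm Omega f) +oo%E.
  by rewrite foo gt0_muley ?lte_fin// addye ?leey// gt_eqF// (lt_le_trans _ gge0).
rewrite -ltey => ffin.
have [goo|] := eqVneq (Linfty_norm (~` Omega) g) +oo%E.
  rewrite goo addey ?leey// gt_eqF// (@lt_le_trans _ _ 0%E)// mule_ge0//.
  by rewrite lee_fin ltW.
rewrite -ltey => gfin.
have /fineK fE : Linfty_norm Omega f \is a fin_num by rewrite ge0_fin_numE.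
have /fineK gE : Linfty_norm (~` Omega) g \is a fin_num by rewrite ge0_fin_numE.
rewrite -fE -gE; set M := fine _; set N := fine _.
have M0 : 0 <= M by exact: fine_ge0.
have N0 : 0 <= N by exact: fine_ge0.
have fM : {ae @lebesgue_rV R n, forall x, Omega x -> `|f x| <= M}.
  by apply/Linfty_normP => //; rewrite fE.
have gN : {ae @lebesgue_rV R n, forall x, (~` Omega) x -> `|g x| <= N}.
  by apply/Linfty_normP => //; rewrite gE.
rewrite -EFinM -EFinD; apply/lee_addgt0Pr => e e0.
rewrite -EFinD; apply/Linfty_normP.
  apply: addr_ge0 (ltW e0); apply: addr_ge0 => //; apply: mulr_ge0 => //.
  exact: ltW.
(* The slack [e] makes [M < k * psi / 2] strict. *)
pose k := (2 * M / psi + e / 2).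
have k0 : 0 <= k.
  by apply: addr_ge0; apply: divr_ge0 => //; rewrite ?mulr_ge0// ltW.
have Mk : M < k * psi / 2.
  rewrite /k (_ : _ * psi / 2 = M + e * psi / 4); last by field; rewrite gt_eqF.
  by rewrite ltrDl divr_gt0// mulr_gt0.
have bound (f' g' u' : 'rV[R]_n.+1 -> R) : measurable_fun Omega f' ->
    {ae @lebesgue_rV R n, forall x, Omega x -> `|f' x| <= M} ->
    {ae @lebesgue_rV R n, forall x, (~` Omega) x -> `|g' x| <= N} ->
    weak_solution nu Omega f' g' u' ->
    {ae @lebesgue_rV R n, forall x, Omega x -> u' x <= 2 * k + N}.
  move=> mf' f'M g'N [Vu' u'g' weak'].
  apply: (@weak_subsolution_bound _ _ nu' nu_levy Omega t i psi mOmega Ofin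
    psiE cosO k M N f' u') => //.
  apply: filterS2 u'g' g'N => x u'g' g'N Ox.
  by rewrite u'g'// (le_trans (ler_norm _))// g'N.
have upper := bound _ _ _ mf fM gN sol.
have lower : {ae @lebesgue_rV R n, forall x, Omega x -> - u x <= 2 * k + N}.
  apply: (bound _ _ _ _ _ _ (weak_solutionN sol)).
  - exact: measurableT_comp.
  - by apply: filterS fM => x; rewrite normrN.
  - by apply: filterS gN => x; rewrite normrN.
apply: filterS2 upper lower => x ux Nux Ox.
have -> : 4 / psi * M + N + e = 2 * k + N by rewrite /k; field; rewrite gt_eqF.
by rewrite ler_norml ux// andbT lerNl Nux.
Qed.
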